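(* Let $\mathbb{F}=\mathbb{F}_q$ be the field with $q$ elements, $V=\mathbb{F}^n$ with $n\ge 1$, and let $G\le \mathrm{GL}_n(\mathbb{F})$ be a subgroup. Let $V=W_1\sqcup\cdots\sqcup W_k$ be the decomposition of $V$ into its $k$ distinct $G$-orbits, let $\gamma=\lceil \log_q(k)\rceil$, and let $n_1,\ldots,n_k\in\mathbb{F}[V]^G$ be the invariants defined in the context. Then: 1. Every separating set for $\mathbb{F}[V]^G$ contains at least $\gamma$ elements. 2. Let $(a_{ij})\in\mathbb{F}^{\gamma\times k}$ be a matrix whose columns are pairwise different, and define $$t_i=a_{i1}n_1+\cdots+a_{ik}n_k\qquad(1\le i\le\gamma).$$ Then $t_1,\ldots,t_\gamma$ form a minimal separating set for $\mathbb{F}[V]^G$ (that is, a separating set with the smallest possible number of elements), consisting of (not necessarily homogeneous) elements of degree less than or equal to $|G|\,n(q-1)$.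
   Context: $\mathbb{F}[V]=\mathbb{F}[x_1,\ldots,x_n]$ is the polynomial ring (as formal polynomials), with $x_1,\ldots,x_n$ the coordinate functions on $V=\mathbb{F}^n$. The group $G$ acts on $\mathbb{F}[V]$ by $\mathbb{F}$-algebra automorphisms, determined on linear forms $f\in V^*$ by $(g\cdot f)(v)=f(g^{-1}v)$. $\mathbb{F}[V]^G=\{f\in\mathbb{F}[V]\mid g\cdot f=f\text{ for all }g\in G\}$. Elements $u,v\in V$ are separated by a set $S\subset\mathbb{F}[V]^G$ if $f(u)\ne f(v)$ for some $f\in S$. A subset $S\subset\mathbb{F}[V]^G$ is called separating for $\mathbb{F}[V]^G$ if any $u,v\in V$ that can be separated by $\mathbb{F}[V]^G$ can also be separated by $S$. For $w=(w_1,\ldots,w_n)\in V$ define $$f_w=(-1)^n\prod_{i=1}^n\ \prod_{a\in\mathbb{F}\setminus\{w_i\}}(x_i-a)\in\mathbb{F}[V].$$ For $1\le j\le k$ define $f_j=\sum_{w\in W_j}f_w$ and $n_j=\prod_{g\in G}(g\cdot f_j)\in\mathbb{F}[V]^G$. *)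

(* Defs.v *)
From HB Require Import structures.
From mathcomp Require Import all_boot all_order all_algebra all_fingroup.
From mathcomp Require Import mpoly.

Set Implicit Arguments.
Unset Strict Implicit.
Unset Printing Implicit Defensive.

Import GRing.Theory.
Local Open Scope ring_scope.

(* {'GL_n[F]} consists of the units of 'M[F]_n.-1.+1, so the dimension n >= 1 *)
(* is written n.+1 throughout.                                                *)

(* The value of the formal polynomial f at the vector v. *)
Definition evalv (F : finFieldType) (n : nat) (f : {mpoly F[n]})
  (v : 'cV[F]_n) : F := f.@[fun i => v i 0].

(* On coordinates, (g . x_i)(v) = (g^-1 v)_i, so the algebra automorphism     *)
(* induced by g substitutes \sum_j (g^-1)_ij x_j for x_i.                     *)
Definition mpact (F : finFieldType) (n : nat) (g : {'GL_n.+1[F]})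
    (f : {mpoly F[n.+1]}) : {mpoly F[n.+1]} :=
  f \mPo [tuple \sum_(j < n.+1) GLval (g^-1)%g i j *: 'X_j | i < n.+1].

Lemma evalv_mpact (F : finFieldType) (n : nat) (g : {'GL_n.+1[F]})
    (f : {mpoly F[n.+1]}) (v : 'cV[F]_n.+1) :
  evalv (mpact g f) v = evalv f (GLval (g^-1)%g *m v).
Proof.
rewrite /evalv /mpact comp_mpoly_meval; apply: meval_eq => i.
rewrite tnth_map tnth_ord_tuple mxE raddf_sum /=.
by apply: eq_bigr => j _; rewrite mevalZ mevalXU.
Qed.

Definition invariant (F : finFieldType) (n : nat) (G : {group {'GL_n.+1[F]}})
    (f : {mpoly F[n.+1]}) : Prop :=
  forall g, g \in G -> mpact g f = f.

Definition separates (F : finFieldType) (n : nat) (S : {mpoly F[n]} -> Prop)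
    (u v : 'cV[F]_n) : Prop :=
  exists2 f, S f & evalv f u <> evalv f v.

Definition separating (F : finFieldType) (n : nat) (G : {group {'GL_n.+1[F]}})
    (S : {mpoly F[n.+1]} -> Prop) : Prop :=
  (forall f, S f -> invariant G f) /\
  (forall u v, separates (invariant G) u v -> separates S u v).

(* The possibly infinite set S has at least m elements. *)
Definition at_least (T : eqType) (m : nat) (S : T -> Prop) : Prop :=
  exists s : seq T, [/\ uniq s, size s = m & forall x, x \in s -> S x].

(* Separating of smallest possible cardinality, not merely inclusion-minimal. *)
Definition minimal_separating (F : finFieldType) (n : nat)
    (G : {group {'GL_n.+1[F]}}) (S : {mpoly F[n.+1]} -> Prop) : Prop :=
  separating G S /\
  (forall S', separating G S' -> forall m, at_least m S -> at_least m S').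

Definition orbitv (F : finFieldType) (n : nat) (G : {group {'GL_n.+1[F]}})
    (v : 'cV[F]_n.+1) : {set 'cV[F]_n.+1} :=
  [set GLval g *m v | g : {'GL_n.+1[F]} in G].

Definition orbit_enum (F : finFieldType) (n : nat) (G : {group {'GL_n.+1[F]}})
    (k : nat) (W : 'I_k -> {set 'cV[F]_n.+1}) : Prop :=
  injective W /\ [set W j | j : 'I_k] = [set orbitv G v | v : 'cV[F]_n.+1].

Definition fpt (F : finFieldType) (n : nat) (w : 'cV[F]_n) : {mpoly F[n]} :=
  (-1) ^+ n * \prod_(i < n) \prod_(a : F | a != w i 0) ('X_i - a%:MP).

Definition fset_sum (F : finFieldType) (n : nat) (A : {set 'cV[F]_n}) :
    {mpoly F[n]} := \sum_(w in A) fpt w.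

Definition norm_inv (F : finFieldType) (n : nat) (G : {group {'GL_n.+1[F]}})
    (A : {set 'cV[F]_n.+1}) : {mpoly F[n.+1]} :=
  \prod_(g in G) mpact g (fset_sum A).

(* Main.v *)
(* The invariant norm_inv G (W j) is the indicator function of the orbit W j, so
   t_1, ..., t_gamma take the value (a_1j, ..., a_gammaj) on W j, and these
   columns are pairwise different.  Conversely m invariants take at most q ^ m
   different values on the k orbits, which they separate only if k <= q ^ m. *)
Require Import Defs.
From HB Require Import structures.
From mathcomp Require Import all_boot all_order all_algebra all_fingroup.
From mathcomp Require Import mpoly cyclic finfield.

Set Implicit Arguments.
Unset Strict Implicit.
Unset Printing Implicit Defensive.

Import GRing.Theory.
Local Open Scope ring_scope.

(** * Values of [fpt] and [fset_sum] *)

Lemma natr_card (R : finNzRingType) : #|R|%:R = 0 :> R.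
Proof.
(* Lagrange's theorem in the additive group of [R], where a group power of [1] is a multiple of
   [1]. *)
have /= := @expg_cardG _ [set: R]%G 1%R (in_setT _).
by rewrite FinRing.zmodXgE cardsT.
Qed.

(* Wilson's theorem for F, by differentiating \prod_a ('X - a) = 'X^q - 'X at w. *)
Lemma prod_subr_neq (F : finFieldType) (w : F) :
  \prod_(a : F | a != w) (w - a) = -1.
Proof.
pose P : {poly F} := \prod_(a : F | a != w) ('X - a%:P).
have PE : P.[w] = \prod_(a : F | a != w) (w - a).
  by rewrite horner_prod; apply: eq_bigr => a _; rewrite hornerXsubC.
have := finField_genPoly F; rewrite (bigD1 w) //= -/P.
move/(congr1 (fun p : {poly F} => p^`().[w])).
rewrite derivM !derivE !hornerE subrr mul0r addr0 hornerMn -PE => <-.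
by rewrite -mulr_natl natr_card mul0r sub0r.
Qed.

(** The [i]-th inner product is -1 by Wilson if [v] and [w] agree at [i], and otherwise vanishes
    through its factor [a = v i 0]; for [v = w] the sign [(-1) ^+ n] cancels the [n] values -1. *)
Lemma evalv_fpt (F : finFieldType) (n : nat) (w v : 'cV[F]_n) :
  evalv (fpt w) v = (v == w)%:R.
Proof.
rewrite /evalv /fpt rmorphM rmorphXn rmorphN1 rmorph_prod /=.
have E i : (\prod_(a : F | a != w i 0) ('X_i - a%:MP_[n])).@[fun i => v i 0]
  = if v i 0 == w i 0 then -1 else 0.
  rewrite rmorph_prod /=.
  under eq_bigr do rewrite rmorphB /= mevalXU mevalC.
  case: eqP => [->|/eqP h]; first exact: prod_subr_neq.
  by rewrite (bigD1 (v i 0)) //= subrr mul0r.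
under eq_bigr do rewrite E.
case: (altP (v =P w)) => [->|nvw].
  under eq_bigr do rewrite eqxx.
  by rewrite prodr_const card_ord -exprMn mulrNN mulr1 expr1n.
have /existsP[i hi] : [exists i, v i 0 != w i 0].
  apply: contraNT nvw; rewrite negb_exists => /forallP h.
  by apply/eqP/colP => i; apply/eqP; move: (h i); rewrite negbK.
by rewrite (bigD1 i) //= (negbTE hi) mul0r mulr0.
Qed.

Lemma evalv_fset_sum (F : finFieldType) (n : nat) (A : {set 'cV[F]_n})
  (v : 'cV[F]_n) : evalv (fset_sum A) v = (v \in A)%:R.
Proof.
rewrite /evalv /fset_sum rmorph_sum /=.
have [vA|vA] := boolP (v \in A).
  rewrite (bigD1 v) //= [X in X + _]evalv_fpt eqxx big1 ?addr0 //.
  by move=> w /andP[_ nw]; rewrite [LHS]evalv_fpt eq_sym (negbTE nw).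
rewrite big1 // => w wA; rewrite [LHS]evalv_fpt.
by case: eqP vA => // ->; rewrite wA.
Qed.

(** * The action on polynomials and its invariants *)

(** Expanding into monomials reduces this to variables, where substituting twice multiplies the
    matrices of [h^-1] and [g^-1], in this order, which gives the matrix of [(g * h)^-1]. *)
Lemma mpactM (F : finFieldType) (n : nat) (g h : {'GL_n.+1[F]})
  (f : {mpoly F[n.+1]}) : mpact g (mpact h f) = mpact (g * h)%g f.
Proof.
rewrite /mpact (comp_mpolyEX f) raddf_sum /= [RHS]comp_mpolyEX.
apply: eq_bigr => m _; rewrite linearZ /=; congr (_ *: _).
rewrite !comp_mpolyX rmorph_prod /=; apply: eq_bigr => i _.
rewrite rmorphXn /= !tnth_map !tnth_ord_tuple raddf_sum /=; congr (_ ^+ _).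
under eq_bigr => j _.
  rewrite linearZ /= comp_mpolyXU -tnth_nth tnth_map tnth_ord_tuple scaler_sumr.
  over.
rewrite exchange_big /=; apply: eq_bigr => l _.
transitivity ((GLval h^-1%g *m GLval g^-1%g) i l *: 'X_l : {mpoly F[n.+1]});
  last by rewrite -GL_MxE -invMg.
rewrite mxE scaler_suml.
by apply: eq_bigr => j _; rewrite scalerA.
Qed.

(** Acting by [g] sends the factor of [h] to that of [g * h], so it only permutes the factors. *)
Lemma norm_inv_invariant (F : finFieldType) (n : nat)
  (G : {group {'GL_n.+1[F]}}) (A : {set 'cV[F]_n.+1}) :
  Defs.invariant G (norm_inv G A).
Proof.
move=> g gG; rewrite /norm_inv {1}/mpact rmorph_prod /=.
rewrite [RHS](reindex_inj (mulgI g)) /=.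
apply: eq_big => [h|h _]; first by rewrite groupMl.
exact: mpactM.
Qed.

Lemma invariant_sum (F : finFieldType) (n k : nat) (G : {group {'GL_n.+1[F]}})
  (c : 'I_k -> F) (f : 'I_k -> {mpoly F[n.+1]}) :
  (forall j, Defs.invariant G (f j)) ->
  Defs.invariant G (\sum_j c j *: f j).
Proof.
move=> inv g gG; rewrite /mpact raddf_sum /=; apply: eq_bigr => j _.
by rewrite linearZ /=; congr (_ *: _); apply: inv.
Qed.

(** * Orbits and their separation by invariants *)

Section Orbits.

Variables (F : finFieldType) (n : nat) (G : {group {'GL_n.+1[F]}}).
Implicit Types u v : 'cV[F]_n.+1.

Lemma orbitv_refl v : v \in orbitv G v.
Proof. by apply/imsetP; exists 1%g; rewrite ?group1 // GL_1E mul1mx. Qed.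

Lemma orbitv_mull g v : g \in G -> orbitv G (GLval g *m v) = orbitv G v.
Proof.
move=> gG; apply/setP => w; apply/imsetP/imsetP => -[h hG ->].
  by exists (h * g)%g; rewrite ?groupM // GL_MxE mulmxA.
exists (h * g^-1)%g; first by rewrite groupM ?groupV.
by rewrite mulmxA -GL_MxE mulgKV.
Qed.

Lemma orbitvP u v : reflect (orbitv G u = orbitv G v) (u \in orbitv G v).
Proof.
apply: (iffP idP) => [/imsetP[g gG ->]|<-]; last exact: orbitv_refl.
exact: orbitv_mull.
Qed.

(** Orbits are stable under [G], so all factors take the same value 0 or 1 at [v]; its power of
    exponent [#|G| > 0] is that value again. *)
Lemma evalv_norm_inv u v :
  evalv (norm_inv G (orbitv G u)) v = (v \in orbitv G u)%:R.
Proof.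
rewrite /evalv /norm_inv rmorph_prod /=.
rewrite (eq_bigr (fun=> (v \in orbitv G u)%:R)) => [|g gG].
  by rewrite prodr_const; case: (v \in _); rewrite ?expr1n // expr0n eqn0Ngt
    cardG_gt0.
rewrite [LHS]evalv_mpact evalv_fset_sum; congr (nat_of_bool _)%:R.
by apply/orbitvP/orbitvP; rewrite orbitv_mull ?groupV.
Qed.

Lemma invariant_evalv f u v :
  Defs.invariant G f -> orbitv G u = orbitv G v -> evalv f u = evalv f v.
Proof.
move=> inv /orbitvP/imsetP[g gG ->].
by rewrite -{1}[g]invgK -evalv_mpact inv ?groupV.
Qed.

(** Invariants are constant on orbits; conversely, the norm of the orbit of [u] is 1 at [u] and 0
    off that orbit. *)
Lemma separates_invariantP u v :
  separates (Defs.invariant G) u v <-> orbitv G u <> orbitv G v.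
Proof.
split=> [[f inv neq] eq_uv|neq]; first exact/neq/invariant_evalv.
exists (norm_inv G (orbitv G u)); first exact: norm_inv_invariant.
rewrite !evalv_norm_inv orbitv_refl; case: orbitvP => [eq_vu|_] /eqP.
  by move: neq; rewrite eq_vu.
by rewrite oner_eq0.
Qed.

Section Enum.

Variables (k : nat) (W : 'I_k -> {set 'cV[F]_n.+1}) (hW : orbit_enum G W).

Lemma orbit_enum_orbitv v : exists j, W j = orbitv G v.
Proof.
have : orbitv G v \in [set W j | j : 'I_k] by rewrite hW.2 imset_f.
by case/imsetP=> j _ ->; exists j.
Qed.

(** Boolean equality lets [xchoose] pick a representative of [W j]. *)
Lemma orbit_enum_rep j : exists v, W j == orbitv G v.
Proof.
have : W j \in [set W j | j : 'I_k] by rewrite imset_f.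
by rewrite hW.2 => /imsetP[v _ ->]; exists v.
Qed.

Lemma evalv_comb_norm_inv (c : 'I_k -> F) j v : W j = orbitv G v ->
  evalv (\sum_i c i *: norm_inv G (W i)) v = c j.
Proof.
move=> Wj; rewrite /evalv rmorph_sum /=.
have E i : (c i *: norm_inv G (W i)).@[fun l => v l 0] = c i * (i == j)%:R.
  have /eqP Wi := xchooseP (orbit_enum_rep i).
  rewrite mevalZ; congr (_ * _); rewrite Wi [LHS]evalv_norm_inv.
  congr (nat_of_bool _)%:R; apply/orbitvP/eqP; rewrite -Wi -Wj; last by move->.
  by move/hW.1.
under eq_bigr do rewrite E.
rewrite (bigD1 j) //= eqxx mulr1 big1 ?addr0 // => i /negbTE ->.
by rewrite mulr0.
Qed.

(** Elements of [S] are collected one by one: as long as there are too few of them to separate all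
    orbits, [S] must contain a new one. *)
Lemma separating_at_least S :
  separating G S -> at_least (up_log #|F| k) S.
Proof.
move=> [Sinv Ssep].
suff H m : (m <= up_log #|F| k)%N -> at_least m S by apply: H.
elim: m => [_|m IHm ltm]; first by exists [::].
have [s [us sz_s sS]] := IHm (ltnW ltm).
pose r j := xchoose (orbit_enum_rep j).
have rP j : W j = orbitv G (r j) by apply/eqP/(xchooseP (orbit_enum_rep j)).
pose val j : (size s).-tuple F :=
    map_tuple (fun f => evalv f (r j)) (in_tuple s).
(* Pigeonhole: were the [k] value tuples of length [m] distinct, then [k <= #|F| ^ m], so
   [up_log #|F| k <= m]. *)
have /injectivePn[i [j neq_ij eq_val]] : ~~ injectiveb val.
  apply/injectiveP => /leq_card; rewrite card_tuple card_ord sz_s.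
  by move/(up_log_min (finNzRing_gt1 F)); rewrite leqNgt ltm.
have [f Sf neq_f] : separates S (r i) (r j).
  apply/Ssep/separates_invariantP; rewrite -!rP => /hW.1 eq_ij.
  by rewrite eq_ij eqxx in neq_ij.
exists (f :: s); split=> /=; last 1 first.
- by move=> x; rewrite inE => /predU1P[->|/sS].
(* All elements of [s] agree at [r i] and [r j], whereas [f] does not. *)
- rewrite us andbT; apply/negP=> fs; apply: neq_f.
  by move/(congr1 (@tval _ _))/eq_in_map: eq_val => /(_ f fs).
- by rewrite sz_s.
Qed.

End Enum.

End Orbits.

(** * Degree bounds, with [msize] as degree plus one *)

Section Degree.

Variable F : fieldType.

Lemma msizeM_leq n (p r : {mpoly F[n]}) a b :
  (msize p <= a.+1 -> msize r <= b.+1 -> msize (p * r) <= (a + b).+1)%N.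
Proof.
have [->|p0] := eqVneq p 0; first by rewrite mul0r msize0.
have [->|r0] := eqVneq r 0; first by rewrite mulr0 msize0.
rewrite msizeM // (mpolySpred mdeg p0) (mpolySpred mdeg r0) !ltnS addSn addnS.
exact: leq_add.
Qed.

Lemma msize_prod_leq n (I : Type) (s : seq I) (P : pred I)
    (f : I -> {mpoly F[n]}) (d : I -> nat) :
  (forall i, P i -> msize (f i) <= (d i).+1)%N ->
  (msize (\prod_(i <- s | P i) f i) <= (\sum_(i <- s | P i) d i).+1)%N.
Proof.
move=> le_fd; elim/big_rec2: _ => [|i e p Pi IH]; first by rewrite msize1.
exact: msizeM_leq (le_fd i Pi) IH.
Qed.

Lemma msize_sum_leq n (I : Type) (s : seq I) (P : pred I)
    (f : I -> {mpoly F[n]}) d :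
  (forall i, P i -> msize (f i) <= d)%N ->
  (msize (\sum_(i <- s | P i) f i) <= d)%N.
Proof.
move=> le_fd; apply: leq_trans (msize_sum _ _ _) _.
by elim/big_ind: _ => // x y lex ley; rewrite geq_max lex.
Qed.

(** A monomial of degree [d] becomes a product of [d] polynomials of degree at most 1. *)
Lemma msize_comp_linear n m (p : {mpoly F[n]}) (l : n.-tuple {mpoly F[m]}) :
  (forall i, msize (tnth l i) <= 2)%N -> (msize (p \mPo l) <= msize p)%N.
Proof.
move=> lin; rewrite comp_mpolyE big_seq; apply: msize_sum_leq => e.
move/msize_mdeg_lt; apply: leq_trans; apply: leq_trans (msizeZ_le _ _) _.
rewrite mdegE; apply: msize_prod_leq => i _; elim: (e i) => [|k IH].
  by rewrite expr0 msize1.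
by rewrite exprS; apply: (@msizeM_leq _ _ _ 1).
Qed.

End Degree.

(** There are [#|G|] factors; each is a linear substitution in a sum of [fpt w], which have [n.+1]
    times [#|F| - 1] factors of degree 1. *)
Lemma msize_norm_inv (F : finFieldType) (n : nat) (G : {group {'GL_n.+1[F]}})
    (A : {set 'cV[F]_n.+1}) :
  (msize (norm_inv G A) <= (#|G| * (n.+1 * (#|F| - 1))).+1)%N.
Proof.
rewrite -sum_nat_const; apply: msize_prod_leq => g _.
apply: leq_trans (msize_comp_linear _ _) _ => [i|].
  rewrite tnth_map tnth_ord_tuple; apply: msize_sum_leq => j _.
  by apply: leq_trans (msizeZ_le _ _) _; rewrite msizeX mdeg1.
apply: msize_sum_leq => w _; rewrite /fpt.
(* The sign contributes degree 0. *)
rewrite -[X in (_ <= X.+1)%N]add0n; apply: msizeM_leq.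
  by rewrite -signr_odd; case: odd; rewrite ?expr0 ?expr1 ?msizeN msize1.
rewrite -[X in (X * _)%N]card_ord -sum_nat_const; apply: msize_prod_leq => i _.
have -> : (#|F| - 1 = \sum_(a : F | a != w i 0%R) 1)%N.
  by rewrite sum1_card subn1 -(cardC1 (w i 0%R)); apply: eq_card.
apply: msize_prod_leq => a _; apply: leq_trans (msizeD_le _ _) _.
by rewrite msizeN msizeC msizeX mdeg1 geq_max /=; case: (_ != _).
Qed.

(** * Linear combinations of the norms as a minimal separating set *)

Theorem theorem1p1 (F : finFieldType) (n : nat) (G : {group {'GL_n.+1[F]}})
    (k : nat) (W : 'I_k -> {set 'cV[F]_n.+1}) (hW : orbit_enum G W) :
  let q := #|F| in
  let gamma := up_log q k in
  (forall S : {mpoly F[n.+1]} -> Prop, separating G S -> at_least gamma S) /\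
  (forall a : 'M[F]_(gamma, k), injective (fun j => col j a) ->
   let t (i : 'I_gamma) : {mpoly F[n.+1]} :=
     \sum_(j < k) a i j *: norm_inv G (W j) in
   minimal_separating G (fun f => exists i, f = t i) /\
   (forall i, (msize (t i) <= (#|G| * (n.+1 * (q - 1))).+1)%N)).
Proof.
move=> q gamma; split=> [S|a a_inj t]; first exact: (separating_at_least hW).
split=> [|i]; last first.
  apply: msize_sum_leq => j _; apply: leq_trans (msizeZ_le _ _) _.
  exact: msize_norm_inv.
split; first split.
- by move=> _ [i ->]; apply: invariant_sum => j; apply: norm_inv_invariant.
- move=> u v /separates_invariantP neq_uv.
  have [ju Wu] := orbit_enum_orbitv hW u.
  have [jv Wv] := orbit_enum_orbitv hW v.
  (* Equal columns [ju] and [jv] would force [ju = jv], hence a common orbit. *)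
  have /existsP[i neq_i] : [exists i, a i ju != a i jv].
    rewrite -negb_forall; apply/forallP => eq_a; apply: neq_uv.
    rewrite -Wu -Wv; congr (W _); apply: a_inj; apply/colP => i.
    by rewrite !mxE; apply/eqP.
  exists (t i); first by exists i.
  rewrite (evalv_comb_norm_inv hW (a i) Wu) (evalv_comb_norm_inv hW (a i) Wv).
  exact/eqP.
move=> S sepS m [s [us sz_s st]].
(* The distinct elements of [s] lie in the image of [t], which is indexed by ['I_gamma]. *)
have le_m : (m <= gamma)%N.
  rewrite -sz_s -(card_ord gamma) cardE -(size_map t).
  apply: uniq_leq_size => // f /st[i ->]; apply: map_f; exact: mem_enum.
have [s' [us' sz' s'S]] := separating_at_least hW sepS.
(* By the lower bound [S] has [gamma] distinct elements, of which [m] are kept. *)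
exists (take m s'); split; first exact: take_uniq.
  by apply: size_takel; rewrite sz'.
by move=> f /mem_take/s'S.
Qed.
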